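(* For every $k\in\mathbb{Z}$, the $\infty$-monodromy matrix $\mathfrak{M}_k^\infty(\underline a)$ is invertible, entire in $\underline a$, and $$\mathfrak{M}_k^\infty(\underline a)=\mathfrak{M}_0^\infty(\omega^k.\underline a).$$ Furthermore, the Stokes-Sibuya connection matrices satisfy the functional relation $$\mathfrak{S}_0(\underline a)\cdots\mathfrak{S}_{m-1}(\underline a)=\big(\mathfrak{M}_0^\infty(\underline a)\big)^{-1}.$$
   Context: $m\ge1$ is an integer; $(\mathfrak{E}_m)$ is the equation $\Phi''(x)=\frac{P_m(x,\underline a)}{x^2}\Phi(x)$ with $P_m(x,\underline a)=x^m+a_1x^{m-1}+\cdots+a_m$, $\underline a\in\mathbb{C}^m$; $x$ lies on the universal covering of $\mathbb{C}^\star$, with $\arg x\in\mathbb{R}$. Fix a sign and put $\omega=e^{\pm2i\pi/m}$; $\omega^c:=\exp(\pm2i\pi c/m)$, and $\omega^kx$ has argument $\arg x\pm2\pi k/m$ (in particular $\omega^mx=e^{\pm2i\pi}x\neq x$ on the covering). For $\lambda\in\mathbb{C}$, $\lambda.\underline a:=(\lambda a_1,\dots,\lambda^ma_m)$. Define $b_{\frac m2-k}(\underline a)$ by the expansion at infinity $\frac{\sqrt{P_m(x,\underline a)}}{x}=x^{\frac m2-1}+\sum_{k\ge1}b_{\frac m2-k}(\underline a)x^{\frac m2-k-1}$. Set $r(\underline a)=\frac12-\frac m4$ if $m$ is odd, $r(\underline a)=\frac12-\frac m4-b_0(\underline a)$ if $m$ is even, and $S(x,\underline a)=\frac2mx^{\frac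 m2}+\sum_{1\le k<m/2}\frac{b_{\frac m2-k}(\underline a)}{\frac m2-k}x^{\frac m2-k}$. $\Phi_0(x,\underline a)$ denotes the unique solution of $(\mathfrak{E}_m)$ which, in every strict sub-sector of $\{|\arg x|<3\pi/m\}$, is asymptotic at infinity to $x^{r(\underline a)}e^{-S(x,\underline a)}\phi_0$, $\phi_0$ a formal series in $x^{-1/2}$ with constant term $1$ (in $x^{-1}$ for $m$ even), locally uniformly in $\underline a$; it extends analytically to the universal covering of $\mathbb{C}^\star$ and is entire in $\underline a$. Put $\Phi_k(x,\underline a)=\Phi_0(\omega^kx,\omega^k.\underline a)$; each $\{\Phi_k,\Phi_{k+1}\}$ is a fundamental system. The Stokes-Sibuya connection matrix $\mathfrak{S}_k(\underline a)$ is defined by $\begin{pmatrix}\Phi_{k-1}\\\Phi_k\end{pmatrix}=\mathfrak{S}_k(\underline a)\begin{pmatrix}\Phi_k\\\Phi_{k+1}\end{pmatrix}$, and the $\infty$-monodromy matrix $\mathfrak{M}_k^\infty(\underline a)$ by $\begin{pmatrix}\Phi_{k-1}\\\Phi_k\end{pmatrix}(\omega^mx,\underline a)=\mathfrak{M}_k^\infty(\underline a)\begin{pmatrix}\Phi_{k-1}\\\Phi_k\end{pmatrix}(x,\underline a)$. *)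

(* Defs.v *)
From HB Require Import structures.
From mathcomp Require Import all_boot all_order all_algebra.
From mathcomp Require Import complex.
From mathcomp Require Import all_classical all_reals all_analysis.

Set Implicit Arguments.
Unset Strict Implicit.
Unset Printing Implicit Defensive.

Import Order.TTheory GRing.Theory Num.Theory.
Import numFieldNormedType.Exports.

Local Open Scope classical_set_scope.
Local Open Scope ring_scope.
Local Open Scope complex_scope.

(* Topology and normed module structure of R[i] over itself, as provided by
   numFieldNormedType for abstract fields only. *)
Section complex_normedtype.
Variable R : realType.
HB.instance Definition _ := PseudoPointedMetric.copy R[i] R[i]^o.
HB.instance Definition _ := GRing.ComAlgebra.copy R[i] R[i]^o.
HB.instance Definition _ := Vector.copy R[i] R[i]^o.
HB.instance Definition _ := NormedModule.copy R[i] R[i]^o.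
End complex_normedtype.

(* Complex exponential: exp(u + iv) = e^u (cos v + i sin v). *)
Definition cexp (R : realType) (z : R[i]) : R[i] :=
  (expR (complex.Re z))%:C * (cos (complex.Im z) +i* sin (complex.Im z)).

(* The universal covering of C^* is represented by the complex plane with
   projection exp: a point x is given by its logarithm
   t = ln |x| + i arg x, so that functions on the covering are functions of t
   and all the powers x^alpha are single-valued. *)
Definition proj (R : realType) (t : R[i]) : R[i] := cexp t.
Definition cmod (R : realType) (t : R[i]) : R := expR (complex.Re t).
Definition carg (R : realType) (t : R[i]) : R := complex.Im t.
Definition cpow (R : realType) (t alpha : R[i]) : R[i] := cexp (alpha * t).

(* d/dx on the covering; since x = exp t, it equals x^-1 d/dt. *)
Definition ddx (R : realType) (f : R[i] -> R[i]) (t : R[i]) : R[i] :=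
  f^`()%classic t / proj t.

(* Complex-analytic on the whole of C^m (Frechet C-differentiability). *)
Definition entire (R : realType) (m : nat) (F : 'rV[R[i]]_m -> R[i]) : Prop :=
  forall a, differentiable F a.

(* The entry a 0 j is the coefficient a_(j+1). *)
Definition Pm (R : realType) (m : nat) (a : 'rV[R[i]]_m) (x : R[i]) : R[i] :=
  x ^+ m + \sum_(j < m) a 0 j * x ^+ (m - j.+1).

Definition is_solution (R : realType) (m : nat) (a : 'rV[R[i]]_m)
    (f : R[i] -> R[i]) : Prop :=
  [/\ forall t, derivable f t 1,
      forall t, derivable (ddx f) t 1
    & forall t, ddx (ddx f) t = Pm a (proj t) / proj t ^+ 2 * f t].

(* b k stands for b_(m/2 - k), with the convention b 0 = 1 for the leading
   term: near infinity the series sum_k b_(m/2-k) x^(m/2-k-1) converges to the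
   branch of sqrt(P_m(x, a)) / x equivalent to x^(m/2-1). *)
Definition is_sqrt_expansion (R : realType) (m : nat) (a : 'rV[R[i]]_m)
    (b : nat -> R[i]) : Prop :=
  b 0%N = 1 /\
  exists rho : R, forall t : R[i], rho < cmod t ->
    exists2 sigma : R[i],
      series (fun k => b k * cpow t (m%:R / 2 - k%:R - 1)) @ \oo --> sigma
    & sigma ^+ 2 = Pm a (proj t) / proj t ^+ 2.

Definition bcoef (R : realType) (m : nat) (a : 'rV[R[i]]_m) : nat -> R[i] :=
  get [set b : nat -> R[i] | is_sqrt_expansion a b].

Definition rexp (R : realType) (m : nat) (a : 'rV[R[i]]_m) : R[i] :=
  if odd m then 1 / 2 - m%:R / 4 else 1 / 2 - m%:R / 4 - bcoef a m./2.

Definition Sexp (R : realType) (m : nat) (a : 'rV[R[i]]_m) (t : R[i]) : R[i] :=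
  2 / m%:R * cpow t (m%:R / 2) +
  \sum_(1 <= k < m | (k.*2 < m)%N)
     bcoef a k / (m%:R / 2 - k%:R) * cpow t (m%:R / 2 - k%:R).

(* The formal series phi_0 is in powers of x^(-1/2) for m odd and of x^(-1)
   for m even. *)
Definition pstep (R : realType) (m : nat) : R := if odd m then 1 / 2 else 1.

(* f(x, a) is asymptotic to x^r(a) e^(-S(x, a)) sum_n c_n(a) x^(- n pstep) at
   infinity in every strict sub-sector of |arg x| < 3 pi / m, locally uniformly
   in a. *)
Definition asymptotic_to (R : realType) (m : nat)
    (f : R[i] -> 'rV[R[i]]_m -> R[i]) (c : nat -> 'rV[R[i]]_m -> R[i]) : Prop :=
  forall alpha beta : R, - (3 * pi / m%:R) < alpha -> beta < 3 * pi / m%:R ->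
  forall (N : nat) (a0 : 'rV[R[i]]_m),
  exists K rho : R, \forall a \near a0, forall t : R[i],
    alpha < carg t < beta -> rho < cmod t ->
    `|f t a * cpow t (- rexp a) * cexp (Sexp a t)
      - \sum_(0 <= n < N) c n a * cpow t (- (n%:R * pstep R m)%:C)|
    <= (K * cmod t `^ (- (N%:R * pstep R m)))%:C.

Definition is_Phi0 (R : realType) (m : nat)
    (Phi0 : R[i] -> 'rV[R[i]]_m -> R[i]) : Prop :=
  [/\ forall a, is_solution a (Phi0^~ a),
      forall t, entire (Phi0 t)
    & exists2 c : nat -> 'rV[R[i]]_m -> R[i],
        forall a, c 0%N a = 1 & asymptotic_to Phi0 c].

(* angle of omega^k, where omega = exp((-1)^s 2 i pi / m); the boolean s is the
   fixed choice of sign. *)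
Definition oangle (R : realType) (s : bool) (m : nat) (k : int) : R :=
  (-1) ^+ s * (2 * pi * k%:~R / m%:R).

Definition omega (R : realType) (s : bool) (m : nat) (k : int) : R[i] :=
  cexp (0 +i* oangle R s m k).

(* The point omega^k x of the covering. *)
Definition orot (R : realType) (s : bool) (m : nat) (k : int) (t : R[i])
  : R[i] := t + (0 +i* oangle R s m k).

(* lambda.a = (lambda a_1, ..., lambda^m a_m) *)
Definition dil (R : realType) (m : nat) (lambda : R[i]) (a : 'rV[R[i]]_m)
  : 'rV[R[i]]_m := \row_j (lambda ^+ j.+1 * a 0 j).

Definition Phi (R : realType) (s : bool) (m : nat)
    (Phi0 : R[i] -> 'rV[R[i]]_m -> R[i]) (k : int)
    (t : R[i]) (a : 'rV[R[i]]_m) : R[i] :=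
  Phi0 (orot s m k t) (dil (omega R s m k) a).

(* The column vector (Phi_(k-1), Phi_k). *)
Definition PhiCol (R : realType) (s : bool) (m : nat)
    (Phi0 : R[i] -> 'rV[R[i]]_m -> R[i]) (k : int)
    (t : R[i]) (a : 'rV[R[i]]_m) : 'cV[R[i]]_2 :=
  \col_i (if i == 0 then Phi s Phi0 (k - 1) t a else Phi s Phi0 k t a).

(* The matrices below are the ones characterized by their defining relation;
   the default value 0 would only be taken if there were no such matrix. *)
Definition connection_matrix (R : realType) (s : bool) (m : nat)
    (Phi0 : R[i] -> 'rV[R[i]]_m -> R[i]) (k : int) (a : 'rV[R[i]]_m)
  : 'M[R[i]]_2 :=
  xget 0 [set S : 'M[R[i]]_2 |
    forall t, PhiCol s Phi0 k t a = S *m PhiCol s Phi0 (k + 1) t a].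

Definition monodromy_matrix (R : realType) (s : bool) (m : nat)
    (Phi0 : R[i] -> 'rV[R[i]]_m -> R[i]) (k : int) (a : 'rV[R[i]]_m)
  : 'M[R[i]]_2 :=
  xget 0 [set M : 'M[R[i]]_2 |
    forall t, PhiCol s Phi0 k (orot s m m t) a = M *m PhiCol s Phi0 k t a].

(* Main.v *)
Require Import Defs.
From mathcomp Require Import all_boot all_order all_algebra.
From mathcomp Require Import complex.
From mathcomp Require Import all_classical all_reals all_analysis.
From mathcomp Require Import ring lra.
Set Implicit Arguments.
Unset Strict Implicit.
Unset Printing Implicit Defensive.
Import Order.TTheory GRing.Theory Num.Theory.
Import numFieldNormedType.Exports.
Local Open Scope classical_set_scope.
Local Open Scope ring_scope.
Local Open Scope complex_scope.

(** Every Phi_k solves the same equation (E_m)(a): rotating x by omega^k while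
    dilating a by omega^k multiplies P_m by omega^(k m) = 1. So the whole proof
    is linear algebra in the space of solutions, once it is known that
    (Phi_(k-1), Phi_k) is a basis of that space.

    Basis. The Wronskian W(f, g) = f g' - g f' (derivatives in x) of two
    solutions has derivative 0, hence is constant. If it vanished for
    (Phi_(k-1), Phi_k), their quotient would be constant along rays. But on
    the ray where Phi_(k-1) is Phi_0 at argument 0 and Phi_k is Phi_0 at
    argument 2 pi / m or - 2 pi / m, the dominant factor
    exp (- (2/m) x^(m/2)) makes the first decay and the second grow, so the
    quotient tends to 0 without vanishing (Phi0_growth, Phi_subdominant). The
    leading term of S decides: its other terms and the power x^r change
    log |Phi_0| by O(|x|^(m/2-1/4)) only. Any solution h is then a combination
    of f and g with constant coefficients by
    h W(f, g) + f W(g, h) + g W(h, f) = 0 (solution_span), so both kinds of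
    matrices exist, and they are unique by linear independence.

    Entire dependence on a. Independence provides points t1 and t2 at which
    the values of Phi_(k-1) and Phi_k form an invertible 2 x 2 matrix, which
    stays invertible for nearby parameters. Solving for the monodromy matrix
    by Cramer's rule expresses its entries locally as quotients of functions
    Phi_l(t, a), which are entire in a by hypothesis. Values rather than
    Cauchy data are used because the hypothesis on Phi_0 says nothing of the
    dependence on a of its derivative in x.

    Relations. Since Phi_(k+l)(x, a) = Phi_k(omega^l x, omega^l.a), the
    matrices M_k(a) and M_0(omega^k.a) satisfy the same defining relation. As
    omega^m = 1 acts trivially on a, the column (Phi_(m-1), Phi_m) is
    (Phi_(-1), Phi_0)(omega^m x, a) = M_0 (Phi_(-1), Phi_0)(x, a); chaining
    the connection relations yields S_0 ... S_(m-1) M_0 = 1, which also shows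
    that M_0, hence every M_k, is invertible. *)

(** * Functions with zero complex derivative *)

(** The epsilon form of a zero derivative does not mention the filter on the
    field, which lets it be carried from R[i] to R along a segment. *)
Lemma derive0P (K : numFieldType) (F : K -> K) (w : K) :
  is_derive w 1 F 0 <-> forall e : K, 0 < e -> exists2 d : K, 0 < d &
    forall h : K, `|h| < d -> `|F (w + h) - F w| <= e * `|h|.
Proof.
split=> [dF e e0|H].
  have dv : derivable F w 1 by exact: ex_derive.
  have v0 : 'D_1 F w = 0 by exact: derive_val.
  have C : (fun h => h^-1 *: ((F \o shift w) (h *: 1) - F w)) @ 0^' --> 'D_1 F w.
    exact: dv.
  rewrite v0 in C.
  move/cvgrPdist_le : C => /(_ _ e0) /nbhs_ballP [d d0 H].
  exists d => // h hd.
  have [->|h0] := eqVneq h 0; first by rewrite addr0 subrr !normr0 mulr0.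
  have := H h; rewrite /ball /= sub0r normrN => /(_ hd h0).
  rewrite sub0r normrN normrM normfV [h%:A]mulr1 [h + w]addrC.
  by rewrite mulrC ler_pdivrMr ?normr_gt0.
have C : (fun h => h^-1 *: ((F \o shift w) (h *: 1) - F w)) @ 0^' --> (0 : K).
  apply/cvgrPdist_le => e e0; have [d d0 Hd] := H _ e0.
  apply/nbhs_ballP; exists d => //= h; rewrite /ball /= sub0r normrN => hd h0.
  rewrite sub0r normrN normrM normfV [h%:A]mulr1 [h + w]addrC.
  by rewrite mulrC ler_pdivrMr ?normr_gt0 // Hd.
apply: DeriveDef; first by apply/cvg_ex; exists 0; exact: C.
exact: (cvg_lim _ C).
Qed.
Section ConstantSegment.
Variable R : realType.
Implicit Types (F : R[i] -> R[i]) (z v : R[i]).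

Lemma derive0_Re_segment F z v (s : R) :
  is_derive (z + s%:C * v) 1 F 0 ->
  is_derive s 1 (fun u : R => complex.Re (F (z + u%:C * v))) 0.
Proof.
move=> /derive0P H; apply/derive0P => e e0.
pose n : R := complex.Re `|v|.
have nE : `|v| = n%:C by rewrite RRe_real // normr_real.
have n0 : 0 <= n by rewrite -ler0c -nE normr_ge0.
have n1 : 0 < n + 1 by rewrite ltr_wpDl.
have [|d d0 Hd] := H (e / (n + 1))%:C; first by rewrite -[0]/(0%:C) ltcR divr_gt0.
have dE : d = (complex.Re d)%:C by rewrite RRe_real // gtr0_real.
exists (complex.Re d / (n + 1)).
  by rewrite divr_gt0 // -ltcR -dE; exact: d0.
move=> h; rewrite ltr_pdivlMr // => hd.
have hE : `|h%:C * v| = (`|h| * n)%:C.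
  by rewrite normrM nE normc_def /= expr0n addr0 sqrtr_sqr -rmorphM.
have := Hd (h%:C * v); rewrite hE dE ltcR.
rewrite (le_lt_trans _ hd) ?ler_wpM2l ?lerDl // => /(_ isT) K.
rewrite -raddfB -lecR.
rewrite rmorphD mulrDl addrA.
apply: le_trans (normc_ge_Re _) (le_trans K _).
rewrite -rmorphM lecR -mulrA ler_wpM2l ?(ltW e0) //.
by rewrite mulrC -mulrA ler_piMr // ler_pdivrMr // mul1r lerDl.
Qed.

Lemma Re_const_segment F z v :
  (forall s : R, 0 <= s <= 1 -> is_derive (z + s%:C * v) 1 F 0) ->
  complex.Re (F (z + v)) = complex.Re (F z).
Proof.
move=> H.
pose phi := fun u : R => complex.Re (F (z + u%:C * v)).
have D (s : R) : 0 <= s <= 1 -> is_derive s (1 : R) phi 0.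
  by move=> /H; exact: derive0_Re_segment.
have [|| c _] := @MVT_segment R phi (cst 0) 0 1 ler01.
- move=> x; rewrite in_itv /= => /andP[/ltW x0 /ltW x1].
  by apply: D; rewrite x0 x1.
- apply: derivable_within_continuous => x; rewrite in_itv /= => xx.
  by have := D _ xx => /@ex_derive.
rewrite mul0r /phi rmorph0 rmorph1 mul1r mul0r addr0 => /eqP.
by rewrite subr_eq0 => /eqP.
Qed.

(** The mean value theorem only handles real-valued functions; the imaginary
    part of F is reached as the opposite of the real part of F times i. *)
Lemma const_segment F z v :
  (forall s : R, 0 <= s <= 1 -> is_derive (z + s%:C * v) 1 F 0) ->
  F (z + v) = F z.
Proof.
move=> H; apply/eqP; rewrite eq_complex (Re_const_segment H) eqxx /=.
apply/eqP/oppr_inj.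
rewrite -!ReiNIm.
apply: (@Re_const_segment (fun x => F x * 'i)) => s s01.
apply/derive0P => e e0; have [d d0 Hd] := (derive0P _ _).1 (H s s01) e e0.
exists d => // h hd; rewrite -mulrBl normrM.
have -> : `|'i| = 1 :> R[i] by rewrite normc_def /= expr0n expr1n add0r sqrtr1.
by rewrite mulr1 Hd.
Qed.

End ConstantSegment.

(** * Wronskians *)

Section Wronskian.
Variables (K : numFieldType) (p Q : K -> K).
Implicit Types f g : K -> K.

(** With p = exp this is the derivation d/dx read in the variable
    t = log x. *)
Let D f t := f^`()%classic t / p t.

Lemma derive1_shift f c :
  (fun t => f (t + c))^`()%classic = (fun t => f^`()%classic (t + c)).
Proof.
apply/funext => t; rewrite /derive1.
have -> : (fun h => h^-1 *: (f (h + t + c) - f (t + c))) =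
    (fun h => h^-1 *: (f (h + (t + c)) - f (t + c))) => //.
by apply/funext => h; rewrite addrA.
Qed.

Lemma derivable_shift f c t :
  derivable f (t + c) 1 -> derivable (fun t => f (t + c)) t 1.
Proof.
rewrite /derivable /=.
have -> : (fun h => h^-1 *: (f (h *: 1 + t + c) - f (t + c))) =
    (fun h => h^-1 *: (f (h *: 1 + (t + c)) - f (t + c))) => //.
by apply/funext => h; rewrite addrA.
Qed.

Lemma derivable_mull f (c : K) t :
  derivable f t 1 -> derivable (fun t => c * f t) t 1.
Proof. by move=> df; apply: derivableM. Qed.

(** Both solutions satisfy the same equation D (D f) = Q f without a term in
    D f, so the two products left after cancellation are Q f g and - Q f g. *)
Lemma wronskian_derive0 f g t : p t != 0 ->
  derivable f t 1 -> derivable g t 1 ->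
  derivable (D f) t 1 -> derivable (D g) t 1 ->
  D (D f) t = Q t * f t -> D (D g) t = Q t * g t ->
  is_derive t 1 (fun t => f t * D g t - g t * D f t) 0.
Proof.
move=> p0 df dg dDf dDg Ef Eg.
have H u v : D u t = v -> u^`()%classic t = v * p t by move=> <-; rewrite divfK.
have Hf : f^`()%classic t = D f t * p t by apply: H.
have Hg : g^`()%classic t = D g t * p t by apply: H.
move/H: Ef => HDf; move/H: Eg => HDg.
have M1 := @is_deriveM K K f (D g) t 1 _ _ (derivableP df) (derivableP dDg).
have M2 := @is_deriveM K K g (D f) t 1 _ _ (derivableP dg) (derivableP dDf).
have := is_deriveB M1 M2; rewrite -!derive1E Hf Hg HDf HDg.
congr (is_derive _ _ _ _).
by rewrite /GRing.scale /=; ring.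
Qed.

Lemma quotient_derive0 f g t : p t != 0 -> g t != 0 ->
  derivable f t 1 -> derivable g t 1 ->
  f t * D g t - g t * D f t = 0 ->
  is_derive t 1 (fun t => f t / g t) 0.
Proof.
move=> p0 g0 df dg W0.
have dV : derivable (fun t => (g t)^-1) t 1 by exact: derivableV.
have := @is_deriveM K K f (fun t => (g t)^-1) t 1 _ _ (derivableP df)
  (derivableP dV).
rewrite deriveV // -!derive1E.
congr (is_derive _ _ _ _).
have -> : f^`()%classic t = D f t * p t by rewrite /D divfK.
have -> : g^`()%classic t = D g t * p t by rewrite /D divfK.
rewrite /GRing.scale /=.
have -> : f t * (- (g t) ^- 2 * (D g t * p t)) + (g t)^-1 * (D f t * p t) =
  - (p t / g t ^+2) * (f t * D g t - g t * D f t) by field.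
by rewrite W0 mulr0.
Qed.

End Wronskian.

(** * Rotations of the covering and dilations of the parameter *)

Local Notation proj := Defs.proj.

Section Rotation.
Variable R : realType.
Implicit Types (z w t : R[i]) (s : bool) (m : nat).

Lemma cexpD z w : cexp (z + w) = cexp z * cexp w.
Proof.
case: z w => a b [c d]; rewrite /cexp /= expRD cosD sinD.
by apply/eqP; rewrite eq_complex /=; apply/andP; split; apply/eqP; ring.
Qed.

Lemma cexp0 : cexp (0 : R[i]) = 1.
Proof.
rewrite /cexp /= expR0 cos0 sin0.
by apply/eqP; rewrite eq_complex /=; apply/andP; split; apply/eqP; ring.
Qed.

Lemma cexp_neq0 z : cexp z != 0.
Proof.
apply/eqP => z0; have := cexp0; rewrite -(subrr z) cexpD z0 mul0r => /eqP.
by rewrite eq_sym oner_eq0.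
Qed.

Lemma norm_cexp z : `|cexp z| = (expR (complex.Re z))%:C.
Proof.
rewrite /cexp normrM !normc_def /= expr0n addr0 sqrtr_sqr cos2Dsin2 sqrtr1.
by rewrite mulr1 ger0_norm // expR_ge0.
Qed.

Lemma Re_scale (x : R) (z : R[i]) : complex.Re (x%:C * z) = x * complex.Re z.
Proof. by case: z => c d /=; rewrite mul0r subr0. Qed.

Lemma cpow_real (x y alpha : R) :
  cpow (x +i* alpha) y%:C =
  (expR (y * x))%:C * (cos (y * alpha) +i* sin (y * alpha)).
Proof.
rewrite /cpow /cexp /=; congr ((expR _)%:C * (cos _ +i* sin _)); ring.
Qed.

Lemma oangleD s m (k l : int) :
  oangle R s m (k + l) = oangle R s m k + oangle R s m l.
Proof. by rewrite /oangle rmorphD /=; ring. Qed.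

Lemma oangle0 s m : oangle R s m 0 = 0.
Proof. by rewrite /oangle; ring. Qed.

Lemma omegaD s m (k l : int) :
  omega R s m (k + l) = omega R s m k * omega R s m l.
Proof.
rewrite /omega -cexpD oangleD; congr cexp.
by apply/eqP; rewrite eq_complex /= addr0 !eqxx.
Qed.

Lemma omega0 s m : omega R s m 0 = 1.
Proof. by rewrite /omega oangle0 -cexp0. Qed.

Lemma omega_full s m : (0 < m)%N -> omega R s m m = 1.
Proof.
move=> m0; rewrite /omega /oangle.
have -> : 2 * pi * m%:~R / m%:R = pi *+ 2 :> R.
  by rewrite -pmulrn mulfK ?pnatr_eq0 -?lt0n // mulr2n; ring.
rewrite /cexp /= expR0 mul1r.
have -> : cos ((-1) ^+ s * (pi *+ 2)) = 1 :> R.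
  by case: s; rewrite /= ?expr1 ?mulN1r ?cosN ?expr0 ?mul1r cos2pi.
have -> : sin ((-1) ^+ s * (pi *+ 2)) = 0 :> R.
  by case: s; rewrite /= ?expr1 ?mulN1r ?sinN ?expr0 ?mul1r sin2pi ?oppr0.
by [].
Qed.

Lemma omega_exp s m (k : int) n : omega R s m k ^+ n = omega R s m (k * n%:Z).
Proof.
elim: n => [|n IH]; first by rewrite expr0 mulr0 omega0.
by rewrite exprSr IH -omegaD intS mulrDr mulr1 addrC.
Qed.

Lemma omega_unity s m (k : int) : (0 < m)%N -> omega R s m k ^+ m = 1.
Proof.
move=> m0; rewrite omega_exp.
have H (n : nat) : omega R s m (n%:Z * m) = 1.
  by rewrite mulrC -omega_exp omega_full // expr1n.
case: (intP k) => [|n|n]; rewrite ?H //.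
have := omegaD s m (n.+1%:Z * m) (- n.+1%:Z * m).
by rewrite H mul1r mulNr subrr omega0 => <-.
Qed.

Lemma orotD s m (k l : int) t :
  orot s m (k + l) t = orot s m k (orot s m l t).
Proof.
rewrite /orot oangleD -addrA; congr (_ + _).
by apply/eqP; rewrite eq_complex /= addr0 addrC !eqxx.
Qed.

Lemma proj_orot s m (k : int) t :
  proj (orot s m k t) = omega R s m k * proj t.
Proof. by rewrite /proj /orot cexpD mulrC. Qed.

Lemma dil1 m (a : 'rV[R[i]]_m) : dil 1 a = a.
Proof. by apply/rowP => j; rewrite !mxE expr1n mul1r. Qed.

Lemma dilM m (l1 l2 : R[i]) (a : 'rV[R[i]]_m) :
  dil l1 (dil l2 a) = dil (l1 * l2) a.
Proof. by apply/rowP => j; rewrite !mxE exprMn mulrA. Qed.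

(** P_m is quasi-homogeneous: a_j has weight j when x has weight 1. *)
Lemma Pm_dil m (l x : R[i]) (a : 'rV[R[i]]_m) :
  Pm (dil l a) (l * x) = l ^+ m * Pm a x.
Proof.
rewrite /Pm mulrDr exprMn; congr (_ + _).
rewrite mulr_sumr; apply: eq_bigr => j _.
have -> : l ^+ m = l ^+ j.+1 * l ^+ (m - j.+1) by rewrite -exprD subnKC.
by rewrite mxE exprMn; ring.
Qed.

End Rotation.

(** * The space of solutions *)

Section Solutions.
Variable R : realType.
Implicit Types (f g h : R[i] -> R[i]) (z t : R[i]) (s : bool) (m : nat).

Lemma proj_neq0 t : proj t != 0.
Proof. exact: cexp_neq0. Qed.

(** Each d/dx brings out one factor omega^k, which is compensated by the
    x^2 in the denominator; the numerator is unchanged as omega^(k m) = 1. *)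
Lemma is_solution_orot s m (k : int) (a : 'rV[R[i]]_m) f : (0 < m)%N ->
  is_solution (dil (omega R s m k) a) f ->
  is_solution a (fun t => f (orot s m k t)).
Proof.
move=> m0 [df ddf E].
pose w := omega R s m k; pose c : R[i] := 0 +i* oangle R s m k.
have w0 : w != 0 by exact: cexp_neq0.
have E1 : ddx (fun t => f (orot s m k t)) =
    fun t => w * ddx f (t + c).
  apply/funext => t; rewrite /ddx (derive1_shift f c).
  rewrite -[t + c]/(orot s m k t) proj_orot -/w.
  have := proj_neq0 t; move: (_^`()%classic _) (Defs.proj t) => u v v0.
  by field; rewrite w0 v0.
have dE1 t : derivable (fun t => ddx f (t + c)) t 1.
  exact/derivable_shift/ddf.
split.
- by move=> t; exact/derivable_shift/df.
- by move=> t; rewrite E1; exact/derivable_mull/dE1.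
move=> t; rewrite {1}/ddx E1 (derive1Ml w (dE1 t)) (derive1_shift (ddx f) c).
have -> : (ddx f)^`()%classic (t + c) = w * proj t * ddx (ddx f) (t + c).
  rewrite {2}/ddx -proj_orot -[t + c]/(orot s m k t).
  have := proj_neq0 (orot s m k t).
  by move: (_^`()%classic _) (Defs.proj _) => u v v0; field.
rewrite E -[t + c]/(orot s m k t) proj_orot Pm_dil omega_unity // mul1r -/w.
have := proj_neq0 t; move: (f _) (Defs.proj t) (Pm _ _) => u v x v0.
by field; rewrite w0 v0.
Qed.

Definition wronskian f g t := f t * ddx g t - g t * ddx f t.

Lemma wronskian_const m (a : 'rV[R[i]]_m) f g :
  is_solution a f -> is_solution a g ->
  forall t, wronskian f g t = wronskian f g 0.
Proof.
move=> [df ddf Ef] [dg ddg Eg] t.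
rewrite -[t in LHS]add0r; apply: const_segment => u _.
set v := 0 + _.
exact: (@wronskian_derive0 _ (@Defs.proj R)
  (fun t => Pm a (proj t) / proj t ^+ 2) f g v (proj_neq0 v)
  (df v) (dg v) (ddf v) (ddg v) (Ef v) (Eg v)).
Qed.

(** Expanding a 3 x 3 determinant with two equal rows gives
    h W(f, g) + f W(g, h) + g W(h, f) = 0, where the Wronskians are
    constants. *)
Lemma solution_span m (a : 'rV[R[i]]_m) f g h :
  is_solution a f -> is_solution a g -> is_solution a h ->
  wronskian f g 0 != 0 ->
  exists c d : R[i], forall t, h t = c * f t + d * g t.
Proof.
move=> sf sg sh W0.
exists (- wronskian g h 0 / wronskian f g 0),
       (- wronskian h f 0 / wronskian f g 0) => t.
apply: (mulfI W0).
have -> : wronskian f g 0 * h t =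
    - (wronskian g h 0 * f t + wronskian h f 0 * g t).
  rewrite -(wronskian_const sf sg t) -(wronskian_const sg sh t).
  rewrite -(wronskian_const sh sf t) /wronskian.
  move: (f t) (g t) (h t) (ddx f t) (ddx g t) (ddx h t) => *.
  by ring.
move: (wronskian f g 0) W0 (wronskian g h 0) (wronskian h f 0) (f t) (g t) => x x0 y z u v.
by field.
Qed.

(** In the logarithmic coordinate a ray from the origin of C^* is a horizontal
    half-line. *)
Definition ray z (u : R) : R[i] := z + u%:C.

(** The part of the convergence of f / g to 0 along the ray from z that is
    enough to exclude a constant quotient. *)
Definition subdominant z f g := exists T : R,
  (forall u, T <= u -> f (ray z u) != 0 /\ g (ray z u) != 0) /\
  forall e : R, 0 < e -> exists2 u, T <= u &
    `|f (ray z u)| <= e%:C * `|g (ray z u)|.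

(** The value of |f / g| at T is positive, and somewhere further it is at most
    half of it. *)
Lemma subdominant_ratio z f g : subdominant z f g -> exists T : R,
  (forall u, T <= u -> g (ray z u) != 0) /\
  exists2 u, T <= u &
    f (ray z u) * g (ray z T) != f (ray z T) * g (ray z u).
Proof.
move=> [T [n0 H]]; exists T; split; first by move=> u /n0[].
have [fT gT] := n0 T (lexx T).
have q0 : 0 < `|f (ray z T)| / `|g (ray z T)|.
  by rewrite divr_gt0 // normr_gt0.
set q := _ / _ in q0.
have qE : q = (complex.Re q)%:C by rewrite RRe_real // gtr0_real.
have q0' : 0 < complex.Re q by rewrite -ltcR -qE; exact: q0.
have [|u Tu Hu] := H (complex.Re q / 2); first by rewrite divr_gt0.
exists u => //; apply/eqP => E.
have [fu gu] := n0 u Tu.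
have gu0 : 0 < `|g (ray z u)| by rewrite normr_gt0.
have gT0 : 0 < `|g (ray z T)| by rewrite normr_gt0.
have E2 : `|f (ray z u)| = q * `|g (ray z u)|.
  apply: (mulIf (lt0r_neq0 gT0)); rewrite -normrM E normrM /q.
  by rewrite mulrAC divfK // lt0r_neq0.
move: Hu; rewrite E2 ler_pM2r // {1}qE lecR.
by rewrite ler_pdivlMr // mulr2n mulrDr mulr1 gerDl leNgt q0'.
Qed.

(** If W(f, g) were 0 then f / g would have zero derivative along the ray,
    hence be constant there. *)
Lemma wronskian_neq0 m (a : 'rV[R[i]]_m) z f g :
  is_solution a f -> is_solution a g -> subdominant z f g ->
  wronskian f g 0 != 0.
Proof.
move=> sf sg /subdominant_ratio[T [g0 [u Tu]]]; apply: contraNneq => W0.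
have W t : wronskian f g t = 0 by rewrite (wronskian_const sf sg).
have [[df _ _] [dg _ _]] := (sf, sg).
have C : f (ray z u) / g (ray z u) = f (ray z T) / g (ray z T).
  have -> : ray z u = ray z T + (u - T)%:C.
    by rewrite /ray -addrA -rmorphD /= [T + _]addrC subrK.
  apply: (@const_segment R (fun t => f t / g t)) => v /andP[v0 v1].
  set y := _ + _.
  apply: (@quotient_derive0 _ (@Defs.proj R) f g y) => //.
  - exact: proj_neq0.
  - rewrite /y /ray -addrA -rmorphM -rmorphD.
    by apply: g0; rewrite lerDl mulr_ge0 // subr_ge0.
  - exact: W.
apply/eqP; move: C; move: (g0 u Tu) (g0 T (lexx T)).
move: (f _) (g _) (f _) (g _) => a1 a2 a3 a4 n2 n4 /eqP.
by rewrite eqr_div // => /eqP.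
Qed.

Lemma subdominant_minor z f g : subdominant z f g ->
  exists t1 t2, f t1 * g t2 - f t2 * g t1 != 0.
Proof.
move=> /subdominant_ratio[T [_ [u _ H]]].
by exists (ray z u), (ray z T); rewrite subr_eq0.
Qed.

End Solutions.

(** * Growth of Phi_0 along rays *)

Section Growth.
Variables (R : realType) (m : nat).
Hypothesis m_gt0 : (0 < m)%N.
Implicit Types (a : 'rV[R[i]]_m) (psi : R -> R).

(** This is |x|^(m/2 - 1/4) at |x| = exp u. The exponent 1/4 leaves room on
    both sides: it is dominated by |x|^(m/2), and dominates every monomial
    x^(m/2 - k) with 1 <= k as well as log |x|, even for m = 1. *)
Let low (u : R) := expR ((m%:R / 2 - 4^-1) * u).

Let m_ge1 : 1 <= m%:R :> R.
Proof. by rewrite ler1n. Qed.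

Let low_ge0 u : 0 <= low u. Proof. exact: expR_ge0. Qed.

Definition lower_order psi :=
  exists C : R, forall u, 0 <= u -> `|psi u| <= C * low u.

Lemma lower_orderD psi1 psi2 : lower_order psi1 -> lower_order psi2 ->
  lower_order (fun u => psi1 u + psi2 u).
Proof.
move=> [C1 H1] [C2 H2]; exists (C1 + C2) => u u0.
by rewrite mulrDl (le_trans (ler_normD _ _)) // lerD // ?H1 ?H2.
Qed.

Lemma lower_order_sum (I : eqType) (r : seq I) (P : pred I)
    (psi : I -> R -> R) :
  (forall i, i \in r -> P i -> lower_order (psi i)) ->
  lower_order (fun u => \sum_(i <- r | P i) psi i u).
Proof.
elim: r => [_|i r IH H].
  by exists 0 => u _; rewrite big_nil normr0 mul0r.
have {}IH : lower_order (fun u => \sum_(i <- r | P i) psi i u).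
  by apply: IH => j jr; apply: H; rewrite inE jr orbT.
have [Pi|Pi] := boolP (P i); last first.
  by case: IH => C HC; exists C => u u0; rewrite big_cons (negbTE Pi) HC.
have [C HC] := lower_orderD (H i (mem_head _ _) Pi) IH.
by exists C => u u0; rewrite big_cons Pi HC.
Qed.

Lemma lower_order_affine (A B : R) : lower_order (fun u => A + B * u).
Proof.
exists (`|A| + `|B| * 4) => u u0.
have u4 : 1 <= 1 + u / 4 by rewrite lerDl divr_ge0.
have H : 1 + u / 4 <= low u.
  apply: le_trans (expR_ge1Dx _) _; rewrite ler_expR.
  by move: m_ge1 u0; nra.
have L1 : 1 <= low u := le_trans u4 H.
rewrite mulrDl (le_trans (ler_normD _ _)) // lerD //.
  by rewrite ler_peMr.
by rewrite normrM (ger0_norm u0) -mulrA ler_wpM2l //; lra.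
Qed.

Lemma lower_order_monomial (c : R[i]) (y alpha : R) : y <= m%:R / 2 - 4^-1 ->
  lower_order (fun u => complex.Re (c * cpow (u +i* alpha) y%:C)).
Proof.
move=> ym; exists (complex.Re `|c|) => u u0; rewrite -lecR.
apply: le_trans (normc_ge_Re _) _.
rewrite normrM cpow_real normrM.
have -> : `|cos (y * alpha) +i* sin (y * alpha)| = 1 :> R[i].
  by rewrite normc_def /= cos2Dsin2 sqrtr1.
have -> : `|(expR (y * u))%:C| = (expR (y * u))%:C.
  by rewrite ger0_norm // ler0c expR_ge0.
rewrite mulr1 rmorphM [X in _ <= X * _]RRe_real ?normr_real // ler_wpM2l // lecR ler_expR.
by rewrite ler_wpM2r.
Qed.

(** Every term of S after the first has an exponent at most m/2 - 1. *)
Lemma Sexp_main a (alpha : R) : lower_order (fun u =>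
  complex.Re (Sexp a (u +i* alpha))
  - 2 / m%:R * cos (m%:R / 2 * alpha) * expR (m%:R / 2 * u)).
Proof.
have half (k : nat) : (m%:R / 2 - k%:R : R[i]) = (m%:R / 2 - k%:R : R)%:C.
  by rewrite rmorphB rmorphM fmorphV !rmorph_nat.
have [C HC] : lower_order (fun u => \sum_(k <- index_iota 1 m | (k.*2 < m)%N)
    complex.Re (bcoef a k / (m%:R / 2 - k%:R) *
      cpow (u +i* alpha) (m%:R / 2 - k%:R)%:C)).
  apply: lower_order_sum => k; rewrite mem_index_iota => /andP[k1 _] _.
  apply: lower_order_monomial.
  have : 1 <= k%:R :> R by rewrite ler1n.
  by lra.
exists C => u u0; have := HC u u0; congr (`|_| <= _).
rewrite /Sexp raddfD raddf_sum /=.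
have -> : (2 / m%:R : R[i]) = (2 / m%:R : R)%:C.
  by rewrite rmorphM fmorphV !rmorph_nat.
have -> : (m%:R / 2 : R[i]) = (m%:R / 2 : R)%:C.
  by rewrite rmorphM fmorphV !rmorph_nat.
rewrite Re_scale cpow_real Re_scale /=.
set X := 2 / _ * (_ * _); set Y := 2 / _ * _ * _.
have -> : X = Y by rewrite /X /Y; ring.
rewrite addrAC subrr add0r; apply: eq_bigr => k _.
by rewrite rmorphB rmorph_nat.
Qed.

End Growth.

Section Phi0Growth.
Variables (R : realType) (m : nat).
Hypothesis m_gt0 : (0 < m)%N.
Variables (Phi0 : R[i] -> 'rV[R[i]]_m -> R[i]) (hPhi0 : is_Phi0 Phi0).

(** The asymptotic expansion truncated after its constant term 1. The bound
    2 pi / m on the argument covers the two rays needed, and keeps them in a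
    strict sub-sector of |arg x| < 3 pi / m. *)
Lemma Phi0_normalized (a : 'rV[R[i]]_m) (alpha : R) :
  `|alpha| <= 2 * pi / m%:R ->
  exists2 T : R, 0 <= T & forall u, T <= u ->
    `|Phi0 (u +i* alpha) a * cpow (u +i* alpha) (- rexp a)
      * cexp (Sexp a (u +i* alpha)) - 1| <= 2^-1.
Proof.
move=> halpha; have [_ _ [c c0 asy]] := hPhi0.
have p0 : 0 < pi / m%:R :> R by rewrite divr_gt0 ?pi_gt0 ?ltr0n.
have E x : x * pi / m%:R = x * (pi / m%:R) :> R by rewrite mulrA.
(* 5/2 is any number strictly between 2 and 3. *)
have [||K [rho H]] := asy (- (5 / 2 * pi / m%:R)) (5 / 2 * pi / m%:R) _ _ 1%N a.
- by rewrite !E; lra.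
- by rewrite !E; lra.
have {}H := nbhs_singleton H.
(* The remainder is at most |K| exp (- u / 2), as pstep is at least 1/2. *)
exists (`|rho| + 4 * `|K|); first by rewrite addr_ge0 // mulr_ge0.
move=> u Tu; set t := u +i* alpha.
have rT : rho <= u.
  by apply: le_trans Tu; rewrite (le_trans (ler_norm _)) // lerDl mulr_ge0.
have KT : 4 * `|K| <= u by apply: le_trans Tu; rewrite lerDr.
have u0 : 0 <= u by apply: le_trans KT; rewrite mulr_ge0.
have := H t; rewrite big_nat1 c0 mul1r.
have -> : cpow t (- (0%:R * pstep R m)%:C) = 1.
  by rewrite mul0r oppr0 /cpow mul0r cexp0.
have h1 : - (5 / 2 * pi / m%:R) < carg t < 5 / 2 * pi / m%:R.
  by move: halpha; rewrite /carg /= ler_norml !E => /andP[]; lra.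
have h2 : rho < cmod t.
  rewrite /cmod /=; apply: lt_le_trans (expR_ge1Dx _); lra.
move=> /(_ h1 h2) Hw; apply: (le_trans Hw).
have -> : 2^-1 = (2^-1 : R)%:C :> R[i] by rewrite fmorphV rmorph_nat.
rewrite lecR mul1r /cmod /= -expRM.
have step : 2^-1 <= pstep R m :> R by rewrite /pstep; case: ifP => _; lra.
apply: (@le_trans _ _ (`|K| * expR (- (u / 2)))).
  rewrite (le_trans (ler_norm _)) // normrM ler_wpM2l //.
  by rewrite ger0_norm ?expR_ge0 // ler_expR; nra.
rewrite expRN ler_pdivrMr ?expR_gt0 //.
by have := expR_ge1Dx (u / 2); lra.
Qed.

Lemma Phi0_growth (a : 'rV[R[i]]_m) (alpha : R) :
  `|alpha| <= 2 * pi / m%:R ->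
  exists C T : R, 0 <= T /\ forall u, T <= u ->
    (expR (- (2 / m%:R * cos (m%:R / 2 * alpha) * expR (m%:R / 2 * u))
           - C * expR ((m%:R / 2 - 4^-1) * u)))%:C
    <= `|Phi0 (u +i* alpha) a|
    <= (expR (- (2 / m%:R * cos (m%:R / 2 * alpha) * expR (m%:R / 2 * u))
           + C * expR ((m%:R / 2 - 4^-1) * u)))%:C.
Proof.
move=> halpha; have [T T0 HT] := Phi0_normalized a halpha.
have [C1 HC1] := Sexp_main a alpha.
have [C2 HC2] : @lower_order R m (fun u =>
    complex.Re (- rexp a * (0 +i* alpha)) + complex.Re (- rexp a) * u).
  exact: lower_order_affine.
(* The summand 1 absorbs the factor between 1/2 and 3/2 left by
   Phi0_normalized. *)
exists (C1 + C2 + 1), T; split=> // u Tu.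
set M := _ * expR (m%:R / 2 * u).
have u0 : 0 <= u by exact: le_trans Tu.
have := HT u Tu; set t := u +i* alpha; set w := (X in `|X - 1|) => Hw.
have := HC1 u u0; have := HC2 u u0.
set low := expR ((_ - _) * u).
have low1 : 1 <= low.
  apply: le_trans (expR_ge1Dx _).
  have m1 : 1 <= m%:R :> R by rewrite ler1n.
  by rewrite lerDl mulr_ge0 //; lra.
rewrite -/t -/M.
have -> : complex.Re (- rexp a * (0 +i* alpha)) + complex.Re (- rexp a) * u =
    complex.Re (- rexp a * t).
  by case: (rexp a) => x y /=; ring.
set P := complex.Re (- rexp a * t); set S := complex.Re (Sexp a t).
move=> HP HS.
have nw : `|Phi0 t a| = `|w| * (expR (- P - S))%:C.
  rewrite /w 2!normrM /cpow !norm_cexp -/P -/S -!mulrA -!rmorphM -!expRD.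
  have -> : P + (S + (- P - S)) = 0 by ring.
  by rewrite expR0 mulr1.
have e1 : 2 <= expR 1 :> R by exact: expR_ge1Dx.
have w_le : `|w| <= (expR 1)%:C.
  have -> : w = (w - 1) + 1 by rewrite subrK.
  apply: le_trans (ler_normD _ _) _; rewrite normr1.
  apply: le_trans (lerD Hw (lexx 1)) _.
  have -> : 2^-1 + 1 = (2^-1 + 1 : R)%:C :> R[i].
    by rewrite rmorphD fmorphV rmorph_nat.
  by rewrite lecR; lra.
have w_ge : (expR (-1))%:C <= `|w|.
  have -> : w = 1 - (1 - w) by rewrite subKr.
  apply: le_trans (lerB_dist _ _); rewrite normr1 distrC.
  apply: le_trans (lerB (lexx 1) Hw).
  have -> : 1 - 2^-1 = (2^-1 : R)%:C :> R[i].
    by rewrite fmorphV rmorph_nat; field.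
  by rewrite lecR expRN lef_pV2 // posrE ?expR_gt0.
rewrite nw; apply/andP; split.
  apply: (@le_trans _ _ ((expR (-1))%:C * (expR (- P - S))%:C)).
    rewrite -rmorphM lecR -expRD ler_expR.
    by move: HP HS; rewrite !ler_norml => /andP[_ ?] /andP[_ ?]; lra.
  by rewrite ler_wpM2r // ler0c expR_ge0.
apply: (@le_trans _ _ ((expR 1)%:C * (expR (- P - S))%:C)).
  by rewrite ler_wpM2r // ler0c expR_ge0.
rewrite -rmorphM lecR -expRD ler_expR.
by move: HP HS; rewrite !ler_norml => /andP[? _] /andP[? _]; lra.
Qed.

(** At argument 0 the factor cos (m alpha / 2) is 1 and Phi_0 decays; at
    argument 2 pi / m or its opposite it is -1 and Phi_0 grows. *)
Lemma Phi0_subdominant (a a' : 'rV[R[i]]_m) (alpha : R) (f g : R[i] -> R[i])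
    (z : R[i]) :
  `|alpha| = 2 * pi / m%:R ->
  (forall u, f (ray z u) = Phi0 (u +i* 0) a) ->
  (forall u, g (ray z u) = Phi0 (u +i* alpha) a') ->
  subdominant z f g.
Proof.
move=> halpha Ef Eg.
have m1 : 1 <= m%:R :> R by rewrite ler1n.
have [|C [T [T0 H]]] := @Phi0_growth a 0 _.
  by rewrite normr0 divr_ge0 // mulr_ge0 // pi_ge0.
have [|C' [T' [T0' H']]] := @Phi0_growth a' alpha _.
  by rewrite halpha.
have cos_alpha : cos (m%:R / 2 * alpha) = -1.
  have E : m%:R / 2 * (2 * pi / m%:R) = pi :> R by field; rewrite gt_eqF //; lra.
  have [a0|a0] := leP 0 alpha.
    by move: halpha; rewrite ger0_norm // => ->; rewrite E cospi.
  by rewrite -cosN -mulrN -(ltr0_norm a0) halpha E cospi.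
rewrite mulr0 cos0 in H; rewrite cos_alpha in H'.
exists (T + T'); split=> [u Tu|e e0].
  have Tu1 : T <= u by apply: le_trans Tu; rewrite lerDl.
  have Tu2 : T' <= u by apply: le_trans Tu; rewrite lerDr.
  rewrite Ef Eg -!normr_gt0.
  have /andP[h _] := H u Tu1; have /andP[h' _] := H' u Tu2.
  split; [apply: lt_le_trans h|apply: lt_le_trans h'];
    by rewrite ltcE /= eqxx expR_gt0.
(* As u is at least 4 X, the factor exp (u / 4) between |x|^(m/2 - 1/4) and
   |x|^(m/2) is at least X, so that (4/m) |x|^(m/2) exceeds the lower order
   terms by e^-1; then expR (- e^-1) <= e concludes. *)
pose X : R := m%:R / 4 * (`|C + C'| + e^-1).
have X0 : 0 <= X by rewrite mulr_ge0 ?addr_ge0 ?divr_ge0 ?invr_ge0 // ltW.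
exists (T + T' + 4 * X); first by rewrite lerDl mulr_ge0.
set u := T + T' + _.
have u0 : 0 <= u by rewrite !addr_ge0 // mulr_ge0.
have Tu : T <= u by rewrite /u; lra.
have Tu' : T' <= u by rewrite /u; lra.
have /andP[_ Hf] := H u Tu; have /andP[Hg _] := H' u Tu'.
rewrite Ef Eg; apply: (le_trans Hf).
apply: le_trans (ler_wpM2l _ Hg); last by rewrite ler0c ltW.
rewrite -rmorphM lecR.
set low := expR ((_ - _) * u); set E := expR (m%:R / 2 * u).
have low1 : 1 <= low.
  apply: le_trans (expR_ge1Dx _).
  by rewrite lerDl mulr_ge0 //; lra.
have EE : X * low <= E.
  have -> : E = expR (u / 4) * low.
    by rewrite /E /low -expRD; congr expR; field.
  rewrite ler_wpM2r ?expR_ge0 //.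
  by apply: le_trans (expR_ge1Dx _); rewrite /u; lra.
have XE : 4 / m%:R * X = `|C + C'| + e^-1.
  by rewrite /X; field; rewrite ?gt_eqF //; lra.
have ee : expR (- e^-1) <= e.
  rewrite expRN -[leRHS]invrK lef_pV2 ?posrE ?invr_gt0 ?expR_gt0 //.
  by apply: le_trans (expR_ge1Dx _); rewrite lerDr.
apply: le_trans (ler_wpM2r _ ee); rewrite ?expR_ge0 // -expRD ler_expR.
have e1 : 0 < e^-1 by rewrite invr_gt0.
have CC := ler_norm (C + C').
have K1 : 4 / m%:R * (X * low) <= 4 / m%:R * E.
  by rewrite ler_wpM2l // divr_ge0.
rewrite mulrA XE mulrDl in K1.
have K2 : (C + C') * low <= `|C + C'| * low.
  by rewrite ler_wpM2r ?expR_ge0.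
have K3 : e^-1 <= e^-1 * low by rewrite ler_peMr // ltW.
have K4 : 4 / m%:R * E = 2 * (2 / m%:R * E) by ring.
rewrite K4 in K1; rewrite mulr1 mulrN1 mulNr opprK.
by move: K1 K2 K3; rewrite mulrDl; lra.
Qed.

End Phi0Growth.

(** * Solutions of 2 x 2 systems with differentiable data *)

Section Differentiability.
Variables (K : numFieldType) (V : normedModType K).
Implicit Types (x : V).

Lemma near_eq_differentiable (W : normedModType K) (F G : V -> W) x :
  (\forall y \near x, G y = F y) -> differentiable G x -> differentiable F x.
Proof.
move=> FG dG; have [Gc GE] := (diff_locallyP _ _).1 dG.
have FE : F \o shift x = cst (F x) + 'd G x +o_ 0 id.
  apply/eqaddoP => e e0; move/eqaddoP : GE => /(_ e e0).
  have : \forall h \near (0 : V), G (h + x) = F (h + x).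
    by move: FG; rewrite (near_shift 0 x) /= subr0.
  apply: filter_app2; apply: nearW => h E.
  by rewrite /= !fctE /= E (nbhs_singleton FG).
by apply/diff_locallyP; rewrite (diff_unique Gc FE).
Qed.

(** The determinant is only known to be nonzero at x; by continuity Cramer's
    formula for F holds in a neighbourhood of x, which is enough. *)
Lemma differentiable_cramer (F G u v f1 g1 f2 g2 : V -> K) x :
  (forall y, F y * f1 y + G y * g1 y = u y) ->
  (forall y, F y * f2 y + G y * g2 y = v y) ->
  f1 x * g2 x - f2 x * g1 x != 0 ->
  differentiable u x -> differentiable v x ->
  differentiable f1 x -> differentiable g1 x ->
  differentiable f2 x -> differentiable g2 x ->
  differentiable F x.
Proof.
move=> Eu Ev det0 du dv df1 dg1 df2 dg2.
pose det y := f1 y * g2 y - f2 y * g1 y.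
have ddet : differentiable det x.
  by apply: differentiableB; apply: differentiableM.
apply: (@near_eq_differentiable _ _
  (fun y => (u y * g2 y - v y * g1 y) * (det y)^-1)).
  have := differentiable_continuous ddet.
  move=> /cvgr_neq0 /(_ det0); apply: filterS => y dy.
  by move: dy; rewrite -Eu -Ev /det => dy; field.
apply: differentiableM; last exact: differentiableV.
by apply: differentiableB; apply: differentiableM.
Qed.

End Differentiability.

(** dil l b is the sum of the coordinates of b times fixed vectors. *)
Lemma differentiable_dil (R : realType) m (l : R[i]) (a : 'rV[R[i]]_m) :
  differentiable (dil l) a.
Proof.
have -> : dil l = (fun b : 'rV[R[i]]_m =>
    \sum_(j < m) b 0 j *: (l ^+ j.+1 *: delta_mx 0 j : 'rV[R[i]]_m)).
  apply/funext => b; rewrite {1}[dil l b]row_sum_delta; apply: eq_bigr => j _.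
  by rewrite mxE scalerA mulrC.
pose F (j : 'I_m) (b : 'rV[R[i]]_m) : 'rV[R[i]]_m :=
  b 0 j *: (l ^+ j.+1 *: delta_mx 0 j).
have -> : (fun b : 'rV[R[i]]_m =>
    \sum_(j < m) b 0 j *: (l ^+ j.+1 *: delta_mx 0 j : 'rV[R[i]]_m))
  = \sum_(j < m) F j.
  by apply/funext => b; rewrite fct_sumE.
apply: differentiable_sum => j.
exact/differentiableZl/differentiable_coord.
Qed.

(** * Connection and monodromy matrices *)

Lemma prodmx_recr (K : pzRingType) d (F : nat -> 'M[K]_d.+1) n :
  \prod_(0 <= l < n.+1) F l = (\prod_(0 <= l < n) F l) *m F n.
Proof. exact: big_nat_recr. Qed.

Section Matrices.
Variables (R : realType) (m : nat).
Hypothesis m_gt0 : (0 < m)%N.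
Variables (s : bool) (Phi0 : R[i] -> 'rV[R[i]]_m -> R[i]).
Hypothesis hPhi0 : is_Phi0 Phi0.
Implicit Types (a : 'rV[R[i]]_m) (k : int) (A B : 'M[R[i]]_2).

Local Notation Phi := (Phi s Phi0).
Local Notation PhiCol := (PhiCol s Phi0).
Local Notation omega := (omega R s m).
Local Notation orot := (orot s m).

Lemma Phi_is_solution k a : is_solution a (Phi k ^~ a).
Proof.
have [sol _ _] := hPhi0.
exact: is_solution_orot (sol (dil (omega k) a)).
Qed.

Lemma Phi_entire k t : entire (Phi k t).
Proof.
move=> a; have [_ ent _] := hPhi0.
apply: (@differentiable_comp _ _ _ _ (dil (omega k)) (Phi0 (orot k t))).
  exact: differentiable_dil.
exact: ent.
Qed.

Lemma dil_omegaD k l a : dil (omega k) (dil (omega l) a) = dil (omega (k + l)) a.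
Proof. by rewrite dilM -omegaD. Qed.

(** The angles add up exactly on the covering, without reduction modulo
    2 pi. *)
Lemma PhiD k l t a : Phi (k + l) t a = Phi k (orot l t) (dil (omega l) a).
Proof. by rewrite /Defs.Phi orotD dil_omegaD. Qed.

Lemma PhiColD k l t a :
  PhiCol (k + l) t a = PhiCol k (orot l t) (dil (omega l) a).
Proof.
apply/colP => i; rewrite !mxE -!PhiD.
by rewrite -[k - 1 + l]addrAC.
Qed.

Lemma dil_full a : dil (omega m) a = a.
Proof. by rewrite omega_full // dil1. Qed.

(** omega^m acts trivially on the parameter but not on the covering. *)
Lemma PhiCol_full k t a : PhiCol (k + m) t a = PhiCol k (orot m t) a.
Proof. by rewrite PhiColD dil_full. Qed.

(** The base point undoes the rotation by omega^(k-1), so that Phi_(k-1) is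
    evaluated as Phi_0 at argument 0 and Phi_k as Phi_0 at the angle of
    omega. *)
Lemma Phi_subdominant k a :
  subdominant (- (0 +i* oangle R s m (k - 1))) (Phi (k - 1) ^~ a) (Phi k ^~ a).
Proof.
apply: (Phi0_subdominant m_gt0 hPhi0 (a := dil (omega (k - 1)) a)
  (a' := dil (omega k) a) (alpha := oangle R s m 1)).
- rewrite /oangle mulr1 normrM normrX normrN1 expr1n mul1r ger0_norm //.
  by rewrite divr_ge0 // mulr_ge0 // pi_ge0.
- move=> u; congr Phi0; rewrite /orot /ray.
  by apply/eqP; rewrite eq_complex /=; apply/andP; split; apply/eqP; ring.
have E : oangle R s m k = oangle R s m (k - 1) + oangle R s m 1.
  by rewrite -oangleD subrK.
move=> u; congr Phi0; rewrite /orot /ray E.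
by apply/eqP; rewrite eq_complex /=; apply/andP; split; apply/eqP; ring.
Qed.

Lemma Phi_span k a (h : R[i] -> R[i]) : is_solution a h ->
  exists c d : R[i], forall t, h t = c * Phi (k - 1) t a + d * Phi k t a.
Proof.
move=> sh; apply: (solution_span (Phi_is_solution _ _) (Phi_is_solution _ _) sh).
by apply: wronskian_neq0 (Phi_subdominant k a); exact: Phi_is_solution.
Qed.

Lemma PhiCol_mulE A k t a i :
  (A *m PhiCol k t a) i 0 = A i 0 * Phi (k - 1) t a + A i 1 * Phi k t a.
Proof.
rewrite mxE big_ord_recl big_ord1 !mxE /=.
by congr (_ + A i _ * _); apply: val_inj.
Qed.

Lemma PhiCol_span k a (h0 h1 : R[i] -> R[i]) :
  is_solution a h0 -> is_solution a h1 ->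
  exists A, forall t,
    \col_i (if i == 0 then h0 t else h1 t) = A *m PhiCol k t a.
Proof.
move=> /(Phi_span k)[c0 [d0 E0]] /(Phi_span k)[c1 [d1 E1]].
exists (\matrix_(i, j) if i == 0 then if j == 0 then c0 else d0
                       else if j == 0 then c1 else d1) => t.
by apply/colP => i; rewrite PhiCol_mulE !mxE E0 E1; case: (i == 0).
Qed.

(** A row killing the columns at the two points of an invertible minor is
    zero. *)
Lemma PhiCol_free k a A B :
  (forall t, A *m PhiCol k t a = B *m PhiCol k t a) -> A = B.
Proof.
move=> AB; have [t1 [t2 D0]] := subdominant_minor (Phi_subdominant k a).
have E t i : (A i 0 - B i 0) * Phi (k - 1) t a + (A i 1 - B i 1) * Phi k t a = 0.
  have := congr1 (fun M : 'cV_2 => M i 0) (AB t).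
  rewrite !PhiCol_mulE; move: (Phi (k - 1) t a) (Phi k t a) => x y.
  by move=> /eqP; rewrite -subr_eq0 => /eqP <-; ring.
apply/matrixP => i j; apply/eqP; rewrite -subr_eq0.
have := (E t1 i, E t2 i); move: D0.
move: (Phi (k - 1) t1 a) (Phi k t1 a) (Phi (k - 1) t2 a) (Phi k t2 a).
move=> f1 g1 f2 g2 D0 [e1 e2].
have z0 : A i 0 - B i 0 = 0.
  apply: (mulIf D0); rewrite mul0r.
  transitivity (((A i 0 - B i 0) * f1 + (A i 1 - B i 1) * g1) * g2
    - ((A i 0 - B i 0) * f2 + (A i 1 - B i 1) * g2) * g1); first by ring.
  by rewrite e1 e2 !mul0r subrr.
have z1 : A i 1 - B i 1 = 0.
  apply: (mulIf D0); rewrite mul0r.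
  transitivity (((A i 0 - B i 0) * f2 + (A i 1 - B i 1) * g2) * f1
    - ((A i 0 - B i 0) * f1 + (A i 1 - B i 1) * g1) * f2); first by ring.
  by rewrite e1 e2 !mul0r subrr.
by case: j => -[|[|//]] p; apply/eqP;
  [rewrite -{1}z0|rewrite -{1}z1]; congr (A i _ - B i _); apply: val_inj.
Qed.

Lemma connection_matrixP k t a :
  PhiCol k t a = connection_matrix s Phi0 k a *m PhiCol (k + 1) t a.
Proof.
have H := PhiCol_span (k + 1) (Phi_is_solution (k - 1) a) (Phi_is_solution k a).
exact: (xgetPex 0 H).
Qed.

Lemma monodromy_matrixP k t a :
  PhiCol k (orot m t) a = monodromy_matrix s Phi0 k a *m PhiCol k t a.
Proof.
have sol l : is_solution a (fun t => Phi l (orot m t) a).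
  have S : is_solution (dil (omega m) a) (Phi l ^~ a).
    by rewrite dil_full; exact: Phi_is_solution.
  exact: (is_solution_orot m_gt0 S).
exact: (xgetPex 0 (PhiCol_span k (sol (k - 1)) (sol k))).
Qed.

Lemma prod_connection_matrix n k a t :
  PhiCol k t a =
  (\prod_(0 <= l < n) connection_matrix s Phi0 (k + l%:Z) a)
    *m PhiCol (k + n%:Z) t a.
Proof.
elim: n => [|n IH]; first by rewrite big_geq // addr0 mul1mx.
rewrite IH prodmx_recr -mulmxA; congr (_ *m _).
by rewrite intS [1 + _]addrC addrA -connection_matrixP.
Qed.

Lemma prod_connection_monodromy a :
  (\prod_(0 <= l < m) connection_matrix s Phi0 l%:Z a)
    *m monodromy_matrix s Phi0 0 a = 1%:M.
Proof.
apply: (@PhiCol_free 0 a) => t; rewrite mul1mx -mulmxA -monodromy_matrixP.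
rewrite -PhiCol_full [RHS](prod_connection_matrix m).
by congr (_ *m _); apply: eq_bigr => l _; rewrite add0r.
Qed.

Lemma monodromy_matrix0_unit a : monodromy_matrix s Phi0 0 a \in unitmx.
Proof. by case/mulmx1_unit: (prod_connection_monodromy a). Qed.

(** A translation by the angle of omega^k turns one defining relation into the
    other, because it commutes with the translation by the angle of
    omega^m. *)
Lemma monodromy_matrixE k a :
  monodromy_matrix s Phi0 k a = monodromy_matrix s Phi0 0 (dil (omega k) a).
Proof.
apply: (@PhiCol_free k a) => t; rewrite -monodromy_matrixP.
rewrite -[k]add0r !PhiColD add0r -monodromy_matrixP.
by rewrite -!orotD addrC.
Qed.

(** The i-th row of the matrix solves the 2 x 2 system given by the defining
    relation at t1 and t2, whose determinant is nonzero at a. The system is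
    written in both orders of the unknowns to obtain either column. *)
Lemma monodromy_matrix_entire k i j :
  entire (fun a => monodromy_matrix s Phi0 k a i j).
Proof.
move=> a; have [t1 [t2 D0]] := subdominant_minor (Phi_subdominant k a).
have d l t : differentiable (Phi l t) a by exact: Phi_entire.
pose h := if i == 0 then Phi (k - 1) else Phi k.
have dh t : differentiable (h t) a by rewrite /h; case: ifP => _; exact: d.
have E t b : monodromy_matrix s Phi0 k b i 0 * Phi (k - 1) t b
    + monodromy_matrix s Phi0 k b i 1 * Phi k t b = h (orot m t) b.
  rewrite -PhiCol_mulE -monodromy_matrixP !mxE /h.
  by case: (i == 0).
have E' t b : monodromy_matrix s Phi0 k b i 1 * Phi k t b
    + monodromy_matrix s Phi0 k b i 0 * Phi (k - 1) t b = h (orot m t) b.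
  by rewrite addrC.
have -> : j = if j == 0 then 0 else 1.
  by case: j => -[|[|//]] p; apply: val_inj.
case: ifP => _.
  exact: (differentiable_cramer (E t1) (E t2) D0
    (dh _) (dh _) (d _ _) (d _ _) (d _ _) (d _ _)).
have D0' : Phi k t1 a * Phi (k - 1) t2 a - Phi k t2 a * Phi (k - 1) t1 a != 0.
  by rewrite -oppr_eq0 opprB [X in X - _]mulrC [X in _ - X]mulrC.
exact: (differentiable_cramer (E' t1) (E' t2) D0'
  (dh _) (dh _) (d _ _) (d _ _) (d _ _) (d _ _)).
Qed.

End Matrices.

Theorem theorem2p9 (R : realType) (m : nat) (hm : (1 <= m)%N) (s : bool)
    (Phi0 : R[i]%C -> 'rV[R[i]%C]_m -> R[i]%C) (hPhi0 : is_Phi0 Phi0) :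
  (forall k : int,
     [/\ forall a : 'rV[R[i]%C]_m, monodromy_matrix s Phi0 k a \in unitmx,
         forall i j : 'I_2, entire (fun a => monodromy_matrix s Phi0 k a i j)
       & forall a : 'rV[R[i]%C]_m,
           monodromy_matrix s Phi0 k a
           = monodromy_matrix s Phi0 0 (dil (omega R s m k) a)]) /\
  (forall a : 'rV[R[i]%C]_m,
     \prod_(0 <= k < m) connection_matrix s Phi0 k%:Z a
     = invmx (monodromy_matrix s Phi0 0 a)).
Proof.
split=> [k|a].
  split=> [a|i j|a].
  - by rewrite monodromy_matrixE // monodromy_matrix0_unit.
  - exact: monodromy_matrix_entire.
  - exact: monodromy_matrixE.
rewrite -[LHS]mulmx1 -(mulmxV (monodromy_matrix0_unit hm s hPhi0 a)).
by rewrite mulmxA prod_connection_monodromy // mul1mx.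
Qed.
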